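(* Let $\gamma(n)=o\left(\sqrt{n/\ln n}\right)$. There is no algorithm that makes a polynomial (in $n$) number of value-oracle queries and is a $\gamma(n)$-approximation algorithm for the (uniform) Submodular Load Balancing problem with monotone submodular functions.
   Context: $V$ is a ground set of $n$ elements; $f:2^V\to\mathbb{R}_{\ge0}$ is submodular ($f(S)+f(T)\ge f(S\cup T)+f(S\cap T)$) and monotone ($f(S)\le f(T)$ for $S\subseteq T$), accessed only via a value oracle returning $f(S)$. Uniform Submodular Load Balancing: given $f$ and a positive integer $m$, find a partition of $V$ into $m$ (possibly empty) sets $V_1,\dots,V_m$ minimizing $\max_i f(V_i)$. A $\gamma$-approximation algorithm outputs a partition whose value is at most $\gamma$ times the optimum. *)

(* Defs.v *)
From HB Require Import structures.
From mathcomp Require Import all_boot all_order all_algebra.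
From mathcomp Require Import all_classical all_reals all_analysis.
Set Implicit Arguments.
Unset Strict Implicit.
Unset Printing Implicit Defensive.
Import Order.TTheory GRing.Theory Num.Theory.
Import numFieldNormedType.Exports.
Local Open Scope ring_scope.

Definition set_nonneg (R : realType) (n : nat) (f : {set 'I_n} -> R) : Prop :=
  forall S : {set 'I_n}, 0 <= f S.

Definition set_monotone (R : realType) (n : nat) (f : {set 'I_n} -> R) : Prop :=
  forall S T : {set 'I_n}, S \subset T -> f S <= f T.

Definition submodular (R : realType) (n : nat) (f : {set 'I_n} -> R) : Prop :=
  forall S T : {set 'I_n}, f (S :|: T)%SET + f (S :&: T)%SET <= f S + f T.

(* The blocks are labelled and may be empty, so finset's [partition], whose
   blocks are nonempty, does not apply. *)
Definition mpartition (n m : nat) (V : {ffun 'I_m -> {set 'I_n}}) : Prop :=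
  (forall i j : 'I_m, i != j -> [disjoint V i & V j]) /\
  (\bigcup_(i < m) V i)%SET = [set: 'I_n]%SET.

(* Only used for nonnegative f, so that the default value 0 is harmless. *)
Definition slb_value (R : realType) (n m : nat) (f : {set 'I_n} -> R)
    (V : {ffun 'I_m -> {set 'I_n}}) : R :=
  \big[Num.max/0]_(i < m) f (V i).

(* For 0 < m this infimum is a minimum, see [slb_opt_attained]. *)
Definition slb_opt (R : realType) (n m : nat) (f : {set 'I_n} -> R) : R :=
  inf [set slb_value f V | V in [set V | @mpartition n m V]]%classic.

(* A deterministic adaptive query strategy: the next query, or the output, is
   an arbitrary function of the oracle's previous answers. *)
Inductive oracle_tree (R : realType) (n m : nat) : Type :=
| Output of {ffun 'I_m -> {set 'I_n}}
| Query of {set 'I_n} & (R -> oracle_tree R n m).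

Fixpoint run (R : realType) (n m : nat) (f : {set 'I_n} -> R)
    (t : oracle_tree R n m) : {ffun 'I_m -> {set 'I_n}} :=
  match t with
  | Output V => V
  | Query Q k => run f (k (f Q))
  end.

Fixpoint query_count (R : realType) (n m : nat) (f : {set 'I_n} -> R)
    (t : oracle_tree R n m) : nat :=
  match t with
  | Output _ => 0%N
  | Query Q k => (query_count f (k (f Q))).+1
  end.

(* Only oracle queries are counted: the computation between them is
   unrestricted, and n and m are known to the algorithm. *)
Definition slb_algorithm (R : realType) : Type :=
  forall n m : nat, oracle_tree R n m.

Definition slb_instance (R : realType) (n m : nat) (f : {set 'I_n} -> R) : Prop :=
  [/\ (0 < n)%N, (0 < m)%N, set_nonneg f, set_monotone f & submodular f].

Definition polynomial_queries (R : realType) (A : slb_algorithm R) : Prop :=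
  exists p : {poly nat}, forall (n m : nat) (f : {set 'I_n} -> R),
    slb_instance m f -> (query_count f (A n m) <= p.[n])%N.

Definition slb_approximation (R : realType) (gamma : nat -> R)
    (A : slb_algorithm R) : Prop :=
  forall (n m : nat) (f : {set 'I_n} -> R), slb_instance m f ->
    mpartition (run f (A n m)) /\
    slb_value f (run f (A n m)) <= gamma n * slb_opt m f.

Lemma slb_opt_attained (R : realType) (n m : nat) (f : {set 'I_n} -> R) :
  (0 < m)%N ->
  exists V : {ffun 'I_m -> {set 'I_n}},
    [/\ mpartition V, slb_value f V = slb_opt m f &
        forall W : {ffun 'I_m -> {set 'I_n}},
          mpartition W -> slb_value f V <= slb_value f W].
Proof.
case: m => // m _.
pose V0 : {ffun 'I_m.+1 -> {set 'I_n}} :=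
  [ffun i => if i == ord0 then [set: 'I_n]%SET else finset.set0].
have V0P : `[< mpartition V0 >].
  apply/asboolP; split=> [i j ij|].
    rewrite !ffunE; case: eqP => [i0|_]; last by rewrite finset.disjoints_subset finset.sub0set.
    case: eqP => [j0|_]; first by rewrite i0 j0 eqxx in ij.
    by rewrite disjoint_sym finset.disjoints_subset finset.sub0set.
  apply/eqP; rewrite finset.eqEsubset finset.subsetT /=.
  by apply: (finset.bigcup_max ord0) => //; rewrite ffunE eqxx.
case: (@arg_minP _ R _ V0 (fun V => `[< mpartition V >]) (slb_value f) V0P).
move=> V /asboolP VP Vmin; exists V; split=> //; last first.
  by move=> W WP; apply: Vmin; apply/asboolP.
apply/eqP; rewrite eq_le; apply/andP; split.
  apply: lb_le_inf; first by exists (slb_value f V), V.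
  by move=> _ [W WP <-]; apply: Vmin; apply/asboolP.
apply: ge_inf; last by exists V.
by exists (slb_value f V) => _ [W WP <-]; apply: Vmin; apply/asboolP.
Qed.

(* Main.v *)
Require Import Defs.
From HB Require Import structures.
From mathcomp Require Import all_boot all_order all_algebra.
From mathcomp Require Import zify.
Set Implicit Arguments.
Unset Strict Implicit.
Unset Printing Implicit Defensive.
Import Order.TTheory GRing.Theory Num.Theory.

(* Take m = 2^t, a = t 2^t, n = m a and b = O(t) = O(ln n).  A uniformly random
   colouring c of the ground set by m colours hides the function
     f2(S) = min(a, sum_j min(b, |S :&: c^-1(j)|)),
   whose optimum is at most b (use the colour classes), behind
     f1(S) = min(a, |S|),
   for which every partition into m blocks has value a.  The two differ on S only
   if, in every subset of S of size min(a, |S|), more than b elements share a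
   colour; the expected number sharing a given colour is at most a / m = t, so an
   exponential moment bound makes this an event of probability n^(-k), with k as
   large as we like.  A union bound over the queries made on f1 and one large
   block of the output gives a colouring for which the algorithm cannot tell f2
   from f1.  The ratio is then at least a / b, of order 2^t, that is, of order
   sqrt(n / ln n). *)

(** * Elementary inequalities for natural numbers *)

(** Bernoulli bounds [(1 + 1/m)^k] by [(m+1)/(m+1-k)]; at [k = m/2] this is at most 2, and squaring
    gives 4. The halving is why the number of colours has the form [h.*2]. *)
Lemma expnS_self_le (h : nat) : (h.*2.+1 ^ h.*2 <= 4 * h.*2 ^ h.*2)%N.
Proof.
have bernoulli m k : (k <= m -> m.+1 ^ k * (m.+1 - k) <= m ^ k * m.+1)%N.
  elim: k => [|k IHk] km; first by rewrite subn0.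
  rewrite !expnS; apply: (@leq_trans (m * (m.+1 ^ k * (m.+1 - k)))).
    rewrite -mulnA mulnCA [leqRHS]mulnCA leq_mul2l; apply/orP; right.
    rewrite !mulnBr; nia.
  by rewrite -mulnA leq_mul2l (IHk (ltnW km)) orbT.
have half : (h.*2.+1 ^ h <= 2 * h.*2 ^ h)%N.
  have := bernoulli h.*2 h; rewrite -addnn leq_addr => /(_ isT) H.
  rewrite -(leq_pmul2r (ltn0Sn h)); apply: (leq_trans _ (leq_trans H _)).
    by rewrite leq_mul2l; apply/orP; right; lia.
  by rewrite mulnAC [leqLHS]mulnC leq_mul2r; apply/orP; right; lia.
by rewrite -[in X in (_ ^ X <= _)%N]muln2 -[in X in (_ <= _ * _ ^ X)%N]muln2
  !expnM (_ : 4 = 2 ^ 2)%N // -expnMn leq_exp2r.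
Qed.

Lemma horner_nat_lt_expn (p : {poly nat}) :
  exists d : nat, forall n : nat, (1 < n)%N -> (p.[n]%R < n ^ d)%N.
Proof.
elim/poly_ind: p => [|p c [d IHd]].
  by exists 0%N => n _; rewrite horner0.
exists (maxn d.+1 c).+1 => n n1; rewrite hornerMXaddC.
have n0 : (0 < n)%N by apply: ltnW.
have cn : (c < n ^ c)%N.
  by case: (c) => // k; apply: leq_trans (ltn_expl _ (ltnSn 1)) _; rewrite leq_exp2r.
have le1 : (p.[n]%R * n <= n ^ maxn d.+1 c)%N.
  apply: leq_trans (leq_pexp2l n0 (leq_maxl _ _)).
  by rewrite expnSr leq_mul2r (ltnW (IHd n n1)) orbT.
have le2 := leq_pexp2l n0 (leq_maxr d.+1 c).
rewrite expnS; apply: (@leq_trans (2 * n ^ maxn d.+1 c)).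
  by rewrite -[(_ + _)%R]/(p.[n]%R * n + c)%N; lia.
by rewrite leq_mul2r n1 orbT.
Qed.

(** * Random colourings and the union bound *)

Definition colour_class {n m : nat} (c : {ffun 'I_n -> 'I_m}) (j : 'I_m) :
  {set 'I_n} := c @^-1: [set j].

Lemma sum_card_colour_class (n m : nat) (c : {ffun 'I_n -> 'I_m})
    (S : {set 'I_n}) :
  (\sum_(j < m) #|S :&: colour_class c j| = #|S|)%N.
Proof.
rewrite -sum1_card (partition_big c xpredT) //=; apply: eq_bigr => j _.
by rewrite -sum1_card; apply: eq_bigl => x; rewrite !inE.
Qed.

(* The colours of distinct elements are independent, so the exponential moment
   factors. *)
Lemma sum_expn_colour_class (n m : nat) (S : {set 'I_n}) (j : 'I_m) :
  (\sum_(c : {ffun 'I_n -> 'I_m}) 2 ^ #|S :&: colour_class c j|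
     = m.+1 ^ #|S| * m ^ #|~: S|)%N.
Proof.
pose w (x : 'I_n) (i : 'I_m) := (if (x \in S) && (i == j) then 2 else 1)%N.
have wE (c : {ffun 'I_n -> 'I_m}) :
    (2 ^ #|S :&: colour_class c j| = \prod_x w x (c x))%N.
  rewrite -prod_nat_const [RHS](bigID (mem (S :&: colour_class c j))) /=.
  rewrite [X in (_ * X)%N]big1 ?muln1; last first.
    by move=> x; rewrite !inE /w => /negbTE ->.
  by apply: eq_bigr => x; rewrite !inE /w => ->.
under eq_bigr do rewrite wE.
rewrite -(bigA_distr_bigA w) (bigID (mem S)) /=; congr (_ * _)%N.
  rewrite -prod_nat_const; apply: eq_bigr => x xS.
  rewrite /w xS (bigD1 j) //= eqxx (eq_bigr (fun=> 1%N)); last first.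
    by move=> i /negbTE ->.
  rewrite sum1_card; have := cardC1 j; rewrite /predC1 card_ord => ->.
  by have := ltn_ord j; lia.
rewrite -prod_nat_const; apply: eq_big => [x|x xS]; first by rewrite inE.
rewrite /w (negbTE xS) /= sum1_card card_ord //.
Qed.

(** Markov and union bound by counting: a colouring unbalanced on some set adds at least [2 ^ b] to
    the sum of [2 ^ #|S :&: colour_class c j|] over [c], [S], [j], while the moments keep this sum
    below [2 ^ b] times the number of colourings. *)
Lemma exists_balanced_colouring (n h t b : nat) (s : seq {set 'I_n}) :
  (0 < h)%N -> (forall S, S \in s -> #|S| <= h.*2 * t)%N ->
  (size s * h.*2 * 4 ^ t < 2 ^ b)%N ->
  exists c : {ffun 'I_n -> 'I_h.*2},
    forall S j, S \in s -> (#|S :&: colour_class c j| <= b)%N.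
Proof.
move=> h0 s_small s_few; set m := h.*2 in s_small s_few *.
have m0 : (0 < m)%N by rewrite double_gt0.
have moment S j : S \in s ->
    (\sum_(c : {ffun 'I_n -> 'I_m}) 2 ^ #|S :&: colour_class c j|
       <= 4 ^ t * m ^ n)%N.
  move=> /s_small Sle; rewrite sum_expn_colour_class.
  have -> : (m ^ n = m ^ #|S| * m ^ #|~: S|)%N by rewrite -expnD cardsC card_ord.
  rewrite mulnA leq_mul2r; apply/orP; right.
  (* Padding to the exponent [m * t] reduces the claim to the [t]-th power of [expnS_self_le]. *)
  rewrite -(@leq_pmul2r (m ^ (m * t - #|S|))) ?expn_gt0 ?m0 //.
  rewrite -mulnA -expnD subnKC //.
  apply: (@leq_trans (m.+1 ^ (m * t))).
    rewrite -{2}(subnKC Sle) expnD leq_mul2l; apply/orP; right.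
    by case: (m * t - _)%N => // k; rewrite leq_exp2r.
  case: (t) => [|k]; first by rewrite muln0.
  by rewrite !expnM -expnMn leq_exp2r // expnS_self_le.
pose crowded (c : {ffun 'I_n -> 'I_m}) S :=
  [exists j, (b < #|S :&: colour_class c j|)%N].
suff /existsP[c /hasPn sc] : [exists c, ~~ has (crowded c) s].
  exists c => S j /sc; rewrite negb_exists => /forallP/(_ j).
  by rewrite -leqNgt.
rewrite -negb_forall; apply/negP => /forallP bad; move: s_few.
rewrite ltnNge => /negP; apply.
rewrite -(@leq_pmul2r (m ^ n)) ?expn_gt0 ?m0 //.
have -> : (2 ^ b * m ^ n = \sum_(c : {ffun 'I_n -> 'I_m}) 2 ^ b)%N.
  by rewrite sum_nat_const card_ffun !card_ord mulnC.
apply: (@leq_trans (\sum_(c : {ffun 'I_n -> 'I_m}) \sum_(S <- s)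
    \sum_(j < m) 2 ^ #|S :&: colour_class c j|)%N).
  apply: leq_sum => c _; have /hasP[S Ss /existsP[j bS]] := bad c.
  rewrite (big_rem S) //= (bigD1 j) //= -!addnA; apply: leq_trans (leq_addr _ _).
  by rewrite leq_exp2l // ltnW.
rewrite exchange_big /= big_seq.
apply: (@leq_trans (\sum_(S <- s | S \in s) m * (4 ^ t * m ^ n))%N).
  apply: leq_sum => S Ss; rewrite exchange_big /=.
  apply: (@leq_trans (\sum_(j < m) 4 ^ t * m ^ n)%N).
    by apply: leq_sum => j _; apply: moment.
  by rewrite sum_nat_const card_ord.
by rewrite -big_seq big_const_seq count_predT iter_addn_0 mulnC !mulnA.
Qed.

(** * Truncations and the two hard set functions *)

Lemma exists_subset_card (T : finType) (A : {set T}) (a : nat) :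
  exists B : {set T}, B \subset A /\ #|B| = minn a #|A|.
Proof.
have : (minn a #|A| <= #|A|)%N by rewrite geq_minr.
case/card_geqP => s [us sz sA]; exists [set x in s]; split.
  by apply/subsetP => x; rewrite inE => /sA.
by rewrite -sz cardsE; apply/card_uniqP.
Qed.

Definition set_monotonen (T : finType) (g : {set T} -> nat) : Prop :=
  forall S S' : {set T}, S \subset S' -> (g S <= g S')%N.

Definition submodularn (T : finType) (g : {set T} -> nat) : Prop :=
  forall S S' : {set T}, (g (S :|: S') + g (S :&: S') <= g S + g S')%N.

Lemma set_monotonen_minn (T : finType) (a : nat) (g : {set T} -> nat) :
  set_monotonen g -> set_monotonen (fun S => minn a (g S)).
Proof. by move=> gM S S' /gM; lia. Qed.

(** If [g S] reaches [a], so does the union, and the intersection is bounded by [g S'];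
    symmetrically for [S']. Otherwise capping only lowers the left side. *)
Lemma submodularn_minn (T : finType) (a : nat) (g : {set T} -> nat) :
  set_monotonen g -> submodularn g -> submodularn (fun S => minn a (g S)).
Proof.
move=> gM gS S S'.
have := gS S S'; have := gM _ _ (subsetIl S S'); have := gM _ _ (subsetIr S S').
have := gM _ _ (subsetUl S S'); have := gM _ _ (subsetUr S S'); lia.
Qed.

Lemma set_monotonen_cardI (T : finType) (C : {set T}) :
  set_monotonen (fun S => #|S :&: C|).
Proof. by move=> S S' SS'; apply/subset_leq_card/setSI. Qed.

Lemma submodularn_cardI (T : finType) (C : {set T}) :
  submodularn (fun S => #|S :&: C|).
Proof.
by move=> S S'; rewrite setIUl setIIl cardsUI.
Qed.

Definition capped_size {n : nat} (a : nat) (S : {set 'I_n}) : nat :=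
  minn a #|S|.

(** The hidden [f2]: rank in the partition matroid with capacity [b] per colour, truncated at
    [a]. *)
Definition capped_profile {n m : nat} (a b : nat) (c : {ffun 'I_n -> 'I_m})
  (S : {set 'I_n}) : nat :=
  minn a (\sum_(j < m) minn b #|S :&: colour_class c j|).

Lemma set_monotonen_profile (n m b : nat) (c : {ffun 'I_n -> 'I_m}) :
  set_monotonen (fun S => \sum_(j < m) minn b #|S :&: colour_class c j|)%N.
Proof.
move=> S S' SS'; apply: leq_sum => j _.
exact: (set_monotonen_minn b (set_monotonen_cardI (colour_class c j)) SS').
Qed.

Lemma set_monotonen_capped_profile (n m a b : nat) (c : {ffun 'I_n -> 'I_m}) :
  set_monotonen (capped_profile a b c).
Proof. exact/set_monotonen_minn/set_monotonen_profile. Qed.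

Lemma submodularn_capped_profile (n m a b : nat) (c : {ffun 'I_n -> 'I_m}) :
  submodularn (capped_profile a b c).
Proof.
apply: submodularn_minn; first exact: set_monotonen_profile.
move=> S S'; rewrite -!big_split; apply: leq_sum => j _.
apply: (@submodularn_minn _ b (fun S => #|S :&: colour_class c j|)).
  exact: set_monotonen_cardI.
exact: submodularn_cardI.
Qed.

Lemma set_monotonen_capped_size (n a : nat) : set_monotonen (@capped_size n a).
Proof. by apply: set_monotonen_minn => S S' /subset_leq_card. Qed.

Lemma submodularn_capped_size (n a : nat) : submodularn (@capped_size n a).
Proof.
apply: submodularn_minn => S S'; first exact: subset_leq_card.
by rewrite cardsUI.
Qed.

(* Testing the balance of [B] suffices even when [S] is larger than [a], since
   the profile is monotone and already reaches the cap on [B]. *)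
Lemma capped_profile_balanced (n m a b : nat) (c : {ffun 'I_n -> 'I_m})
    (B S : {set 'I_n}) :
  B \subset S -> #|B| = minn a #|S| ->
  (forall j, #|B :&: colour_class c j| <= b)%N ->
  capped_profile a b c S = capped_size a S.
Proof.
move=> BS cB bal; apply/eqP; rewrite eqn_leq; apply/andP; split.
  rewrite leq_min geq_minl /=; apply: leq_trans (geq_minr _ _) _.
  rewrite -(sum_card_colour_class c S); apply: leq_sum => j _.
  exact: geq_minr.
apply: leq_trans (set_monotonen_capped_profile a b c BS).
rewrite leq_min /capped_size geq_minl -cB -(sum_card_colour_class c B) /=.
by apply: leq_sum => j _; rewrite leq_min bal leqnn.
Qed.

(** * Values of partitions under the two functions *)

Lemma leq_card_bigcup (T : finType) (m : nat) (V : 'I_m -> {set T}) :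
  (#|\bigcup_(i < m) V i| <= \sum_(i < m) #|V i|)%N.
Proof.
elim/big_ind2: _ => [|x S y S' le1 le2|//]; first by rewrite cards0.
by apply: leq_trans (leq_card_setU _ _) (leq_add _ _).
Qed.

Lemma mpartition_has_large_block (m a : nat) (V : {ffun 'I_m -> {set 'I_(m * a)}}) :
  (0 < m)%N -> mpartition V -> exists i, (a <= #|V i|)%N.
Proof.
move=> m0 [_ Vcover]; apply/existsP; apply: contraT.
rewrite negb_exists => /forallP small.
have := leq_card_bigcup V; rewrite Vcover cardsT card_ord leqNgt => /negP[].
(* One extra unit per block makes the inequality strict, as [m] is positive. *)
apply: (@leq_trans (\sum_(i < m) #|V i|.+1)%N).
  rewrite [leqRHS](eq_bigr (fun i => #|V i| + 1)%N) => [|i _]; last by rewrite addn1.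
  by rewrite big_split /= sum_nat_const card_ord muln1 -[ltnLHS]addn0 ltn_add2l.
rewrite -[in leqRHS](card_ord m) -sum_nat_const; apply: leq_sum => i _.
by rewrite ltnNge small.
Qed.

Lemma mpartition_colour_class (n m : nat) (c : {ffun 'I_n -> 'I_m}) :
  mpartition [ffun j => colour_class c j].
Proof.
split=> [i j ij|].
  rewrite !ffunE -setI_eq0; apply/eqP/setP => x; rewrite !inE.
  by apply/negP => /andP[/eqP ci /eqP cj]; rewrite -ci -cj eqxx in ij.
apply/setP => x; rewrite inE; apply/bigcupP; exists (c x) => //.
by rewrite ffunE !inE.
Qed.

Lemma capped_profile_colour_class (n m a b : nat) (c : {ffun 'I_n -> 'I_m})
    (j : 'I_m) :
  (capped_profile a b c (colour_class c j) <= b)%N.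
Proof.
apply: leq_trans (geq_minr _ _) _; rewrite (bigD1 j) //= big1 ?addn0 ?geq_minl //.
move=> i ij; rewrite (_ : _ :&: _ = set0) ?cards0 ?minn0 //.
apply/setP => x; rewrite !inE.
by apply/negP => /andP[/eqP cj /eqP ci]; rewrite -ci -cj eqxx in ij.
Qed.

From mathcomp Require Import all_classical all_reals all_analysis.
From mathcomp Require Import ring lra.
Import numFieldNormedType.Exports.
Local Open Scope classical_set_scope.
Local Open Scope ring_scope.

(** * Adaptive queries and indistinguishability *)

Fixpoint queries (R : realType) (n m : nat) (f : {set 'I_n} -> R)
    (t : oracle_tree R n m) : seq {set 'I_n} :=
  match t with
  | Output _ => [::]
  | Query Q k => Q :: queries f (k (f Q))
  end.

Lemma size_queries (R : realType) (n m : nat) (f : {set 'I_n} -> R)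
    (t : oracle_tree R n m) :
  size (queries f t) = query_count f t.
Proof. by elim: t => //= Q k ->. Qed.

(** Equal answers keep both runs on one branch, so agreement on the sets asked under [f] suffices
    despite adaptivity. *)
Lemma eq_in_run (R : realType) (n m : nat) (f g : {set 'I_n} -> R)
    (t : oracle_tree R n m) :
  {in queries f t, f =1 g} -> run g t = run f t.
Proof.
elim: t => //= Q k IHk fg; rewrite -fg ?mem_head //.
by apply: IHk => S Sq; apply: fg; rewrite in_cons Sq orbT.
Qed.

Lemma slb_instance_natr (R : realType) (n m : nat) (g : {set 'I_n} -> nat) :
  (0 < n)%N -> (0 < m)%N -> set_monotonen g -> submodularn g ->
  slb_instance m (fun S => (g S)%:R : R).
Proof.
move=> n0 m0 gM gS; split=> // S T; first by rewrite ler_nat; apply: gM.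
by rewrite -!natrD ler_nat.
Qed.

Lemma slb_opt_capped_profile (R : realType) (n m a b : nat)
    (c : {ffun 'I_n -> 'I_m}) :
  (0 < m)%N -> slb_opt m (fun S => (capped_profile a b c S)%:R : R) <= b%:R.
Proof.
move=> m0; set f := fun S => _.
have [V [_ <- /(_ _ (mpartition_colour_class c)) Vmin]] := slb_opt_attained f m0.
apply: le_trans Vmin _; apply/bigmax_leP; split=> // j _.
by rewrite ffunE ler_nat capped_profile_colour_class.
Qed.

(* Against the answers for [capped_size a], some balanced colouring remains
   consistent with every query and with a large block of the output. *)
Lemma slb_query_lower_bound (R : realType) (h t b : nat) (g : R)
    (A : oracle_tree R (h.*2 * (h.*2 * t)) h.*2) :
  (0 < h)%N -> (0 < t)%N ->
  (forall f, slb_instance h.*2 f ->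
     mpartition (run f A) /\ slb_value f (run f A) <= g * slb_opt h.*2 f) ->
  ((query_count (fun S => (capped_size (h.*2 * t) S)%:R) A).+1 * h.*2 * 4 ^ t
     < 2 ^ b)%N ->
  (h.*2 * t)%:R <= `|g| * b%:R.
Proof.
move=> h0 t0 approx few; set m := h.*2 in A approx few *; set a := (m * t)%N in A approx few *.
have m0 : (0 < m)%N by rewrite double_gt0.
have n0 : (0 < m * a)%N by rewrite !muln_gt0 m0 t0.
set f1 := (fun S : {set 'I_(m * a)} => (capped_size a S)%:R) in few.
have f1P : slb_instance m f1.
  apply: slb_instance_natr => //.
    exact: set_monotonen_capped_size.
  exact: submodularn_capped_size.
have [part1 _] := approx _ f1P.
have [i ai] := mpartition_has_large_block m0 part1.
pose tests := run f1 A i :: queries f1 A.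
(* Balance is available only for sets of size at most [m * t = a], so each test is first cut down to
   that size. *)
have /choice[trunc truncP] : forall S : {set 'I_(m * a)}, exists B : {set 'I_(m * a)},
    B \subset S /\ #|B| = minn a #|S| by move=> S; apply: exists_subset_card.
have [c bal] : exists c : {ffun 'I_(m * a) -> 'I_m},
    forall S j, S \in map trunc tests -> (#|S :&: colour_class c j| <= b)%N.
  apply: (@exists_balanced_colouring _ _ t) => //; last first.
    by rewrite size_map /= size_queries.
  by move=> _ /mapP[S _ ->]; rewrite (truncP S).2 geq_minl.
pose f2 S : R := (capped_profile a b c S)%:R.
have f12 : {in tests, f1 =1 f2}.
  move=> S St; rewrite /f1 /f2; congr _%:R; apply/esym.
  apply: (capped_profile_balanced (truncP S).1 (truncP S).2) => j.
  by apply: bal; apply: map_f.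
have f2P : slb_instance m f2.
  apply: slb_instance_natr => //.
    exact: set_monotonen_capped_profile.
  exact: submodularn_capped_profile.
have [_] := approx _ f2P; rewrite (@eq_in_run _ _ _ f1); last first.
  by move=> S Sq; apply: f12; rewrite in_cons Sq orbT.
move=> val2.
(* This allows [g], of unknown sign, to be replaced by its absolute value. *)
have opt_ge0 : 0 <= slb_opt m f2.
  have [V [_ <- _]] := slb_opt_attained f2 m0.
  by apply: bigmax_ge_id.
apply: (@le_trans _ _ (slb_value f2 (run f1 A))).
  apply: le_trans (le_bigmax _ _ i); rewrite -f12 ?mem_head //.
  by rewrite ler_nat leq_min leqnn.
apply: le_trans val2 _; apply: (@le_trans _ _ (`|g| * slb_opt m f2)).
  by rewrite ler_wpM2r // ler_norm.
by rewrite ler_wpM2l // slb_opt_capped_profile.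
Qed.

(** * Asymptotics and choice of parameters *)

Lemma ln4_ge1 (R : realType) : 1 <= ln (4 : R).
Proof.
have := @le_ln1Dx R (- 2^-1); rewrite ltrN2 invf_lt1 ?ltr1n // => /(_ isT).
have -> : 1 - 2^-1 = 2^-1 :> R by lra.
rewrite lnV ?posrE // lerN2 => H.
have -> : 4 = 2 ^+ 2 :> R by lra.
by rewrite lnXn // mulr2n; lra.
Qed.

(** With [n = 4 ^ t * t], [ln n >= t * ln 4 >= t], hence [n / ln n <= 4 ^ t]. *)
Lemma sqrt_div_ln_le (R : realType) (t : nat) : (0 < t)%N ->
  Num.sqrt ((2 ^ t * (2 ^ t * t))%:R / ln (2 ^ t * (2 ^ t * t))%:R) <= (2 ^ t)%:R :> R.
Proof.
move=> t0; set n := (2 ^ t * _)%N.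
have nE : n = (4 ^ t * t)%N by rewrite /n mulnA -expnMn.
have tln : t%:R <= ln n%:R :> R.
  apply: (@le_trans _ _ (ln (4 ^ t)%:R)).
    by rewrite natrX lnXn // -[leRHS]mulr_natr ler_peMl ?ln4_ge1.
  rewrite ler_ln ?posrE ?ltr0n ?expn_gt0 // ?nE ?muln_gt0 ?expn_gt0 //.
  by rewrite ler_nat leq_pmulr.
have lnn0 : 0 < ln n%:R :> R by apply: lt_le_trans tln; rewrite ltr0n.
rewrite -[leRHS]ger0_norm // -sqrtr_sqr ler_sqrt ?sqr_ge0 //.
rewrite ler_pdivrMr // {1}/n mulnA natrM -natrX -mulnn.
by rewrite ler_wpM2l.
Qed.

Theorem theorem17 (R : realType) (gamma : nat -> R)
    (hgamma : (gamma : nat -> R^o) =o_\oo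
       (fun n : nat => Num.sqrt (n%:R / ln n%:R) : R^o)) :
  ~ exists A : slb_algorithm R,
      polynomial_queries A /\ slb_approximation gamma A.
Proof.
case=> A [[p Ap] Agamma]; have [d pd] := horner_nat_lt_expn p.
(* Queries cost [2 ^ (3 * t * d)] and [m * 4 ^ t] is [2 ^ (3 * t)]; one more [t] in the exponent
   makes the bound strict. *)
pose K := (3 * d + 4)%N.
have K0 : 0 < K%:R :> R by rewrite ltr0n /K addn4.
(* The forced ratio is [a / b = 2 ^ t / K]; this constant keeps [gamma n] below half of it. *)
have /eqoP/(_ ((2 * K%:R)^-1)) := hgamma.
rewrite invr_gt0 mulr_gt0 // => /(_ isT)[N _ hN].
pose t := N.+1; pose h := (2 ^ N)%N.
have hE : h.*2 = (2 ^ t)%N by rewrite -mul2n expnS.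
have h0 : (0 < h)%N by rewrite expn_gt0.
have t0 : (0 < t)%N by [].
have t2 := ltn_expl t (ltnSn 1).
pose n := (h.*2 * (h.*2 * t))%N.
have nt : (t <= n)%N by rewrite /n hE; nia.
have n1 : (1 < n)%N by rewrite /n hE; nia.
have n8 : (n <= 2 ^ (3 * t))%N.
  by rewrite /n hE !mulSn mul0n addn0 !expnD !leq_mul2l ltnW ?orbT.
have bound := slb_query_lower_bound h0 t0 (Agamma n h.*2) (b := (K * t)%N).
have /bound : ((query_count (fun S : {set 'I_n} => (capped_size (h.*2 * t) S)%:R : R)
    (A n h.*2)).+1 * h.*2 * 4 ^ t < 2 ^ (K * t))%N.
  set q := query_count _ _.
  have qle : (q < n ^ d)%N.
    apply: leq_ltn_trans (pd n n1); apply: Ap; apply: slb_instance_natr.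
    - exact: ltnW.
    - by rewrite double_gt0.
    - exact: set_monotonen_capped_size.
    - exact: submodularn_capped_size.
  have nd : (n ^ d <= 2 ^ (3 * t * d))%N.
    by rewrite expnM; case: (d) => // k; rewrite leq_exp2r.
  rewrite hE (_ : 4 = 2 ^ 2)%N // -expnM -mulnA -expnD.
  apply: (@leq_ltn_trans (2 ^ (3 * t * d) * 2 ^ (t + 2 * t))).
    by rewrite leq_mul2r (leq_trans qle nd) orbT.
  by rewrite -expnD ltn_exp2l // /K; nia.
have /= := hN n (ltnW nt); rewrite [X in _ * X]ger0_norm ?sqrtr_ge0 // => gle ge.
have : `|gamma n| <= (2 * K%:R)^-1 * (2 ^ t)%:R.
  apply: le_trans gle _; rewrite ler_wpM2l ?invr_ge0 ?mulr_ge0 //.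
  by rewrite /n hE sqrt_div_ln_le.
move=> /(ler_wpM2r (ler0n R (K * t))) => gle'.
have := le_trans ge gle'; rewrite hE !natrM.
have -> : (2 * K%:R)^-1 * (2 ^ t)%:R * (K%:R * t%:R) = 2^-1 * ((2 ^ t)%:R * t%:R) :> R.
  by field; rewrite gt_eqF.
have : 0 < (2 ^ t)%:R * t%:R :> R by rewrite mulr_gt0 ?ltr0n ?expn_gt0.
by lra.
Qed.
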